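(* Let $d\in\mathbb{Z}$ with $d>1$, let $q=1/d$, and let $\sigma_d=\tau_q$ be the automorphism of $Q(\mathcal{C})$ given by $\tau_q(a/b)=\tau_q(a)/\tau_q(b)$ for $a,b\in\mathcal{C}$, $b\neq0$, where $\tau_q\{a(t)\}=\{q\,a(qt)\}$ on $\mathcal{C}$. Then $\sigma_d h=h^d$. Moreover, the derivation $D'=-h^{-1}\frac{d}{ds}$ of $Q(\mathcal{C})$ satisfies $D'h=1$, and $(Q(\mathcal{C}),D',\sigma_d)$ is a DT field with $$D'\sigma_d=d\,h^{d-1}\sigma_dD',$$ i.e. $D'(\sigma_d x)=d\,h^{d-1}\,\sigma_d(D'x)$ for all $x\in Q(\mathcal{C})$.
   Context: $\mathcal{C}$ is the set of complex-valued continuous functions on $[0,\infty)$; $f\in\mathcal{C}$ is written $\{f(t)\}$. It is a commutative ring without identity under pointwise addition and the convolution product $\{f(t)\}\{g(t)\}=\{\int_0^t f(t-u)g(u)\,du\}$. By Titchmarsh's theorem it has no zero divisors, and $Q(\mathcal{C})$ denotes its field of fractions; $a\in\mathcal{C}$ is identified with $ab/b$ for any nonzero $b\in\mathcal{C}$. A complex number $\alpha$ is identified with $\{\alpha\}/\{1\}\in Q(\mathcal{C})$, which makes $\mathbb{C}$ a subfield of $Q(\mathcal{C})$. Put $l=\{1\}\in\mathcal{C}$ (the constant function $1$) and $s=1/l\in Q(\mathcal{C})$. For $\lambda\geq 0$ let $H_\lambda(t)=0$ for $0\le t\le\lambda$ and $H_\lambda(t)=1$ for $t>\lambda$. The translation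 operator is $h^\lambda=s\cdot\dfrac{\{\int_0^tH_\lambda(u)\,du\}}{l}\in Q(\mathcal{C})$. One has $h^0=1$ and $h^\lambda h^\mu=h^{\lambda+\mu}$, and $h$ denotes $h^1$ (so $h^n$ is the $n$-th power of $h$ for integers $n\ge0$). The derivation $\frac{d}{ds}$ of $Q(\mathcal{C})$ is the unique extension, by the quotient rule, of the map $\{a(t)\}\mapsto\{-t\,a(t)\}$ on $\mathcal{C}$. The map $\tau_q$ is a bijection of $\mathcal{C}$ respecting addition and convolution, so the formula $\tau_q(a/b)=\tau_q(a)/\tau_q(b)$ gives a well-defined automorphism of $Q(\mathcal{C})$. A DT field is a field equipped with both a derivation and a transforming operator (an injective endomorphism). *)

(* Defs.v *)
From mathcomp Require Import all_boot all_algebra.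
From Stdlib Require Import Reals Lra.
From Stdlib Require Import FunctionalExtensionality ProofIrrelevance ClassicalEpsilon.
From Coquelicot Require Import Coquelicot.

Set Implicit Arguments.
Unset Strict Implicit.
Unset Printing Implicit Defensive.

Definition nonneg (t : R) : Prop := (0 <= t)%R.

(* Continuity is only required on [0, +oo[ (in the subspace topology).  The
   values at negative arguments carry no information: they are pinned by
   [cf_neg] so that Leibniz equality is equality on [0, +oo[ (see [cfunP]). *)
Record cfun := CFun {
  cf :> R -> C;
  cf_cont : continuous_on nonneg cf;
  cf_neg : forall t, cf (Rmax 0 t) = cf t }.

Section Continuity.
Local Open Scope R_scope.

Lemma cfunP (f g : cfun) : (forall t, 0 <= t -> f t = g t) -> f = g.
Proof.
case: f g => [f fc fn] [g gc gn] /= E.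
have {}E : f = g.
  apply: functional_extensionality => t.
  by rewrite -fn -gn; apply: E; apply: Rmax_l.
by subst g; rewrite (proof_irrelevance _ fc gc) (proof_irrelevance _ fn gn).
Qed.

Lemma continuous_clamp (x : R) : continuous (Rmax 0) x.
Proof.
move=> P [e He]; exists e => y Hy; apply: He.
rewrite /ball /= /AbsRing_ball /= /abs /minus /plus /opp /= in Hy *.
move: Hy => /Rabs_def2 [h1 h2]; apply: Rabs_def1; rewrite /Rmax.
  by case: (Rle_dec 0 x) => ?; case: (Rle_dec 0 y) => ?; lra.
by case: (Rle_dec 0 x) => ?; case: (Rle_dec 0 y) => ?; lra.
Qed.

Lemma continuous_cf (f : cfun) (x : R) : continuous f x.
Proof.
apply: (continuous_ext (fun t => f (Rmax 0 t))); first exact: cf_neg.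
have H := @cf_cont f (Rmax 0 x) (Rmax_l 0 x).
rewrite /continuous.
apply: (filterlim_comp _ _ _ (Rmax 0) f _ _ _ _ H).
move=> P HP; apply: (filter_imp (F := locally x) _ _ _ (continuous_clamp HP)) => y Hy.
exact: (Hy (Rmax_l 0 y)).
Qed.

Lemma clamp_cont (f : R -> C) : continuous_on nonneg f ->
  continuous_on nonneg (fun t => f (Rmax 0 t)).
Proof.
move=> Hf x Hx; apply: (filterlim_within_ext nonneg f).
  by move=> y Hy; rewrite Rmax_right.
by rewrite Rmax_right //; apply: Hf.
Qed.

Lemma clamp_neg (f : R -> C) (t : R) : f (Rmax 0 (Rmax 0 t)) = f (Rmax 0 t).
Proof. by rewrite [Rmax 0 (Rmax 0 t)]Rmax_right //; apply: Rmax_l. Qed.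

Definition mkcfun (f : R -> C) (fc : continuous_on nonneg f) : cfun :=
  CFun (clamp_cont fc) (clamp_neg f).

Lemma mkcfunE f fc t : 0 <= t -> @mkcfun f fc t = f t.
Proof. by move=> t0 /=; rewrite Rmax_right. Qed.

Lemma cont_on (f : R -> C) : (forall x, 0 <= x -> continuous f x) ->
  continuous_on nonneg f.
Proof.
move=> Hf x Hx P HP.
exact: (filter_le_within nonneg _ (Hf x Hx P HP)).
Qed.

Lemma continuous_pairR (f : R -> C) (x : R) :
  continuous (fun t => fst (f t)) x -> continuous (fun t => snd (f t)) x ->
  continuous f x.
Proof.
move=> H1 H2.
apply: (continuous_ext (fun t => (fst (f t), snd (f t)))).
  by move=> t; case: (f t).
move=> P [e He].
have := filter_and (F := locally x) _ _ (H1 _ (locally_ball (fst (f x)) e))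
  (H2 _ (locally_ball (snd (f x)) e)).
move=> H; refine (filter_imp (F := locally x) _ _ _ (H _)) => y [h1 h2].
by apply: (He ((f y).1, (f y).2)); split.
Qed.

Lemma continuous_re (f : R -> C) (x : R) :
  continuous f x -> continuous (fun t => fst (f t)) x.
Proof.
move=> H; apply: (continuous_comp f (fun z : C => fst z)) => //.
by case: (f x) => a b; apply: (@continuous_fst R_UniformSpace R_UniformSpace).
Qed.

Lemma continuous_im (f : R -> C) (x : R) :
  continuous f x -> continuous (fun t => snd (f t)) x.
Proof.
move=> H; apply: (continuous_comp f (fun z : C => snd z)) => //.
by case: (f x) => a b; apply: (@continuous_snd R_UniformSpace R_UniformSpace).
Qed.

Lemma continuous_Rmul (f g : R -> R) (x : R) :
  continuous f x -> continuous g x -> continuous (fun t => f t * g t) x.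
Proof. exact: (@continuous_mult R_UniformSpace R_AbsRing). Qed.

Lemma continuous_Radd (f g : R -> R) (x : R) :
  continuous f x -> continuous g x -> continuous (fun t => f t + g t) x.
Proof. exact: (@continuous_plus R_UniformSpace R_AbsRing R_NormedModule). Qed.

Lemma continuous_Rsub (f g : R -> R) (x : R) :
  continuous f x -> continuous g x -> continuous (fun t => f t - g t) x.
Proof. exact: (@continuous_minus R_UniformSpace R_AbsRing R_NormedModule). Qed.

Lemma continuous_Cmul (f g : R -> C) (x : R) :
  continuous f x -> continuous g x -> continuous (fun t => Cmult (f t) (g t)) x.
Proof.
move=> Hf Hg.
have [[[f1 f2] g1] g2] := (continuous_re Hf, continuous_im Hf, continuous_re Hg, continuous_im Hg).
apply: continuous_pairR => /=.
  by apply: continuous_Rsub; apply: continuous_Rmul.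
by apply: continuous_Radd; apply: continuous_Rmul.
Qed.

Lemma continuous_RtoC (f : R -> R) (x : R) :
  continuous f x -> continuous (fun t => RtoC (f t)) x.
Proof. by move=> Hf; apply: continuous_pairR => //=; apply: continuous_const. Qed.

Lemma continuous_lin (f : R -> C) (a b x : R) :
  (forall y, continuous f y) -> continuous (fun t => f (a * t + b)) x.
Proof.
move=> Hf; apply: (continuous_comp (fun t => a * t + b) f) => //.
apply: continuous_Radd; last exact: continuous_const.
by apply: continuous_Rmul; [exact: continuous_const | exact: continuous_id].
Qed.

Lemma continuous_rev (f : R -> C) (t u : R) :
  (forall y, continuous f y) -> continuous (fun u => f (t - u)) u.
Proof.
move=> Hf; apply: (continuous_ext (fun u => f (-1 * u + t))).
  by move=> v; congr (f _); lra.
exact: continuous_lin.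
Qed.

Lemma ex_RInt_conv (f g : R -> C) (t a b : R) :
  (forall y, continuous f y) -> (forall y, continuous g y) ->
  @ex_RInt C_R_NormedModule (fun u => Cmult (f (t - u)) (g u)) a b.
Proof.
move=> Hf Hg.
apply: (@ex_RInt_continuous C_R_CompleteNormedModule) => z _.
by apply: continuous_Cmul => //; apply: continuous_rev.
Qed.

Lemma abs_RInt_orient (f : R -> R) (a b M : R) :
  (forall x, continuous f x) ->
  (forall x, Rmin a b <= x <= Rmax a b -> Rabs (f x) <= M) ->
  Rabs (RInt f a b) <= Rabs (b - a) * M.
Proof.
move=> Hf HM.
have ex c d : ex_RInt f c d by apply: ex_RInt_continuous.
case: (Rle_dec a b) => Hab.
  rewrite (Rabs_pos_eq (b - a)); last lra.
  apply: abs_RInt_le_const => // x Hx; apply: HM.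
  by rewrite Rmin_left ?Rmax_right.
rewrite -(opp_RInt_swap (V := R_CompleteNormedModule)) // /opp /= Rabs_Ropp.
rewrite Rabs_minus_sym (Rabs_pos_eq (a - b)); last lra.
apply: abs_RInt_le_const => //; first lra.
by move=> x Hx; apply: HM; rewrite Rmin_right ?Rmax_left; lra.
Qed.

Lemma bounded_on (f : R -> R) (T : R) : (forall x, continuous f x) ->
  exists M, 0 < M /\ forall x, - T <= x <= T -> Rabs (f x) <= M.
Proof.
move=> Hf; case: (Rle_dec (-T) T) => HT; last first.
  by exists 1; split; [lra | move=> x Hx; lra].
have Hc c : -T <= c <= T -> continuity_pt (fun x => Rabs (f x)) c.
  move=> _; apply/continuity_pt_filterlim.
  exact: (continuous_comp f Rabs c (Hf c) (continuous_Rabs _)).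
have [m [Hm _]] := continuity_ab_maj _ _ _ HT Hc.
exists (Rabs (f m) + 1); split; first by have := Rabs_pos (f m); lra.
by move=> x /Hm; lra.
Qed.

Lemma continuous_conv (f g : R -> R) (t0 : R) :
  (forall x, continuous f x) -> (forall x, continuous g x) ->
  continuous (fun t => RInt (fun u => f (t - u) * g u) 0 t) t0.
Proof.
move=> Hf Hg.
have frev t x : continuous (fun u => f (t - u)) x.
  apply: (continuous_comp (fun u => t - u) f) => //.
  by apply: continuous_Rsub; [exact: continuous_const | exact: continuous_id].
set T := Rabs t0 + 1.
have T0 : 0 < T by rewrite /T; have := Rabs_pos t0; lra.
have [Mf [Mf0 HMf]] := bounded_on (2 * T) Hf.
have [Mg [Mg0 HMg]] := bounded_on T Hg.
apply/filterlim_locally => e.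
pose K := T * Mg + Mf * Mg.
have K0 : 0 < K.
  by rewrite /K; apply: Rplus_lt_0_compat; apply: Rmult_lt_0_compat.
have e'0 : 0 < e / (2 * K).
  by apply: Rdiv_lt_0_compat; [exact: cond_pos | lra].
have [d Hd] := @unifcont_normed_1d R_AbsRing R_NormedModule f (- (2 * T)) (2 * T)
  (fun x _ => Hf x) (mkposreal _ e'0).
have m0 : 0 < Rmin (Rmin d 1) (e / (2 * K)).
  by apply: Rmin_glb_lt => //; apply: Rmin_glb_lt; [exact: cond_pos | lra].
exists (mkposreal _ m0) => t Ht.
have {}Ht : Rabs (t - t0) < Rmin (Rmin d 1) (e / (2 * K)) by exact: Ht.
have [Htd [Ht1 Hte]] : Rabs (t - t0) < d /\ Rabs (t - t0) < 1 /\ Rabs (t - t0) < e / (2 * K).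
  have := (Rmin_l (Rmin d 1) (e / (2 * K)), Rmin_r (Rmin d 1) (e / (2 * K)),
           Rmin_l d 1, Rmin_r d 1).
  by move=> [[[h1 h2] h3] h4]; split; [|split]; lra.
have [tT t0T] : (- T <= t <= T) /\ (- T <= t0 <= T).
  move: Ht1; rewrite /T /Rabs; do 2 case: Rcase_abs => ?; lra.
have ex1 s a b : ex_RInt (fun u => f (s - u) * g u) a b.
  apply: (@ex_RInt_continuous R_CompleteNormedModule) => z _.
  by apply: continuous_Rmul.
suff H : Rabs (RInt (fun u => f (t - u) * g u) 0 t - RInt (fun u => f (t0 - u) * g u) 0 t0) < e.
  exact: H.
rewrite -(RInt_Chasles _ 0 t0 t) // /plus /=.
set A := RInt _ 0 t0; set B := RInt _ t0 t; set D := RInt _ 0 t0.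
have -> : A + B - D = RInt (fun u => (f (t - u) - f (t0 - u)) * g u) 0 t0 + B.
  have -> : A + B - D = (A - D) + B by lra.
  congr (_ + _); have -> : A - D = minus A D by [].
  rewrite /A /D -(RInt_minus (V := R_CompleteNormedModule)) //.
  by apply: RInt_ext => x _; rewrite /minus /plus /opp /=; lra.
have HB : Rabs B <= Rabs (t - t0) * (Mf * Mg).
  apply: abs_RInt_orient => [x|x Hx]; first exact: continuous_Rmul.
  have {}Hx : - T <= x <= T.
    by move: Hx; rewrite /Rmin /Rmax; case: Rle_dec => ?; lra.
  rewrite Rabs_mult; apply: Rmult_le_compat; try exact: Rabs_pos.
    by apply: HMf; lra.
  exact: HMg.
have HA : Rabs (RInt (fun u => (f (t - u) - f (t0 - u)) * g u) 0 t0)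
          <= Rabs (t0 - 0) * (e / (2 * K) * Mg).
  apply: abs_RInt_orient => [x|x Hx].
    by apply: continuous_Rmul => //; apply: continuous_Rsub.
  have {}Hx : - T <= x <= T.
    by move: Hx; rewrite /Rmin /Rmax; case: Rle_dec => ?; lra.
  rewrite Rabs_mult; apply: Rmult_le_compat; try exact: Rabs_pos; last exact: HMg.
  apply: Rlt_le; apply: (Hd (t0 - x) (t - x)); try lra.
  rewrite /ball /= /AbsRing_ball /= /abs /minus /plus /opp /=.
  by have -> : t - x + - (t0 - x) = t - t0 by lra.
have t0T' : Rabs (t0 - 0) <= T by rewrite Rminus_0_r /T; lra.
apply: Rle_lt_trans (Rabs_triang _ _) _.
have h1 : Rabs (t0 - 0) * (e / (2 * K) * Mg) <= T * (e / (2 * K) * Mg).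
  by apply: Rmult_le_compat_r => //; apply: Rlt_le; apply: Rmult_lt_0_compat.
have h2 : Rabs (t - t0) * (Mf * Mg) < e / (2 * K) * (Mf * Mg).
  by apply: Rmult_lt_compat_r => //; apply: Rmult_lt_0_compat.
have h3 : T * (e / (2 * K) * Mg) + e / (2 * K) * (Mf * Mg) = e / 2.
  have -> : T * (e / (2 * K) * Mg) + e / (2 * K) * (Mf * Mg) = e / (2 * K) * K
    by rewrite /K; ring.
  by field; lra.
by have := cond_pos e; lra.
Qed.

End Continuity.

Definition cconv (f g : R -> C) (t : R) : C :=
  RInt (V := C_R_CompleteNormedModule) (fun u => Cmult (f (t - u)%R) (g u)) 0 t.

Section ConvCont.
Local Open Scope R_scope.

Lemma cconv_cont (f g : cfun) : continuous_on nonneg (cconv f g).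
Proof.
apply: cont_on => x _.
have [fc gc] := (@continuous_cf f, @continuous_cf g).
have [[[f1 f2] g1] g2] :=
  (fun x => continuous_re (fc x), fun x => continuous_im (fc x),
   fun x => continuous_re (gc x), fun x => continuous_im (gc x)).
pose J (p q : R -> R) t := RInt (fun u => p (t - u) * q u) 0 t.
have exJ p q t : (forall x, continuous p x) -> (forall x, continuous q x) ->
    ex_RInt (fun u => p (t - u) * q u) 0 t.
  move=> Hp Hq; apply: (@ex_RInt_continuous R_CompleteNormedModule) => z _.
  apply: continuous_Rmul => //.
  apply: (continuous_comp (fun u => t - u) p) => //.
  by apply: continuous_Rsub; [exact: continuous_const | exact: continuous_id].
apply: (continuous_ext (fun t =>
  (J (fun s => fst (f s)) (fun s => fst (g s)) t -
   J (fun s => snd (f s)) (fun s => snd (g s)) t,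
   J (fun s => fst (f s)) (fun s => snd (g s)) t +
   J (fun s => snd (f s)) (fun s => fst (g s)) t) : C)).
  move=> t; apply: esym; apply: (is_RInt_unique (V := C_R_CompleteNormedModule)).
  apply: (@is_RInt_fct_extend_pair R_NormedModule R_NormedModule) => /=.
    apply: (is_RInt_minus (V := R_NormedModule)); apply: (RInt_correct (V := R_CompleteNormedModule)).
      exact: (exJ _ _ t f1 g1).
    exact: (exJ _ _ t f2 g2).
  apply: (is_RInt_plus (V := R_NormedModule)); apply: (RInt_correct (V := R_CompleteNormedModule)).
    exact: (exJ _ _ t f1 g2).
  exact: (exJ _ _ t f2 g1).
apply: continuous_pairR => /=.
  by apply: continuous_Rsub; apply: continuous_conv.
by apply: continuous_Radd; apply: continuous_conv.
Qed.

End ConvCont.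

Section CFunRing.
Local Open Scope R_scope.

Lemma cadd_cont (f g : cfun) :
  continuous_on nonneg (fun t => Cplus (f t) (g t)).
Proof.
apply: cont_on => x _.
apply: (continuous_plus (V := C_R_NormedModule)); exact: continuous_cf.
Qed.

Lemma cconst_cont (c : C) : continuous_on nonneg (fun=> c).
Proof. by apply: cont_on => x _; apply: continuous_const. Qed.

Lemma cder_cont (f : cfun) :
  continuous_on nonneg (fun t => Cmult (RtoC (- t)) (f t)).
Proof.
apply: cont_on => x _; apply: continuous_Cmul; last exact: continuous_cf.
apply: continuous_RtoC.
exact: (continuous_opp (V := R_NormedModule) _ _ (continuous_id x)).
Qed.

Lemma ctau_cont (q : R) (f : cfun) :
  continuous_on nonneg (fun t => Cmult (RtoC q) (f (q * t))).
Proof.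
apply: cont_on => x _; apply: continuous_Cmul; first exact: continuous_const.
apply: (continuous_ext (fun t => f (q * t + 0))).
  by move=> t; congr (cf f _); lra.
by apply: continuous_lin => y; apply: continuous_cf.
Qed.

Definition Hstep (lam t : R) : R := if Rle_dec t lam then 0 else 1.

Lemma is_RInt_Hstep (lam t : R) : 0 <= t ->
  is_RInt (Hstep lam) 0 t (Rmax 0 (t - Rmax 0 lam)).
Proof.
move=> t0; set m := Rmax 0 lam.
have [m0 mlam] : 0 <= m /\ lam <= m by split; [exact: Rmax_l | exact: Rmax_r].
have mE x : 0 < x < m -> x <= lam.
  by rewrite /m /Rmax; case: Rle_dec => ? ?; lra.
case: (Rle_dec t m) => Ht.
  rewrite Rmax_left; last lra.
  apply: (is_RInt_ext (fun=> 0)).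
    move=> x; rewrite Rmin_left // Rmax_right // => Hx.
    by rewrite /Hstep; case: Rle_dec => // H; case: H; apply: mE; lra.
  have := is_RInt_const 0 t (0 : R_NormedModule).
  by rewrite /scal /= /mult /= Rmult_0_r.
rewrite Rmax_right; last lra.
have -> : t - m = plus 0 (t - m) by rewrite /plus /=; lra.
apply: (is_RInt_Chasles (V := R_NormedModule) _ 0 m t).
  apply: (is_RInt_ext (fun=> 0)).
    move=> x; rewrite Rmin_left // Rmax_right // => Hx.
    by rewrite /Hstep; case: Rle_dec => // H; case: H; apply: mE; lra.
  have := is_RInt_const 0 m (0 : R_NormedModule).
  by rewrite /scal /= /mult /= Rmult_0_r.
apply: (is_RInt_ext (fun=> 1)).
  move=> x; rewrite Rmin_left ?Rmax_right; try lra.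
  by move=> Hx; rewrite /Hstep; case: Rle_dec => // ?; lra.
have := is_RInt_const m t (1 : R_NormedModule).
by rewrite /scal /= /mult /= Rmult_1_r.
Qed.

Lemma cintH_cont (lam : R) :
  continuous_on nonneg (fun t => RtoC (RInt (Hstep lam) 0 t)).
Proof.
move=> x Hx.
apply: (filterlim_within_ext nonneg (fun t => RtoC (Rmax 0 (t - Rmax 0 lam)))).
  by move=> t Ht; rewrite (is_RInt_unique _ _ _ _ (@is_RInt_Hstep lam t Ht)).
rewrite (is_RInt_unique _ _ _ _ (@is_RInt_Hstep lam x Hx)).
move: x Hx; apply: cont_on => x _; apply: continuous_RtoC.
apply: (continuous_comp (fun t => t - Rmax 0 lam) (Rmax 0)); last exact: continuous_clamp.
by apply: continuous_Rsub; [exact: continuous_id | exact: continuous_const].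
Qed.

End CFunRing.

Definition cconst (c : C) : cfun := mkcfun (@cconst_cont c).
Definition cadd (f g : cfun) : cfun := mkcfun (@cadd_cont f g).
Definition cmul (f g : cfun) : cfun := mkcfun (@cconv_cont f g).
Definition cder (f : cfun) : cfun := mkcfun (@cder_cont f).
Definition ctau (q : R) (f : cfun) : cfun := mkcfun (@ctau_cont q f).
Definition cintH (lam : R) : cfun := mkcfun (@cintH_cont lam).

Section CFunTheory.
Local Open Scope R_scope.

Lemma cintHE (lam t : R) : 0 <= lam -> 0 <= t ->
  cintH lam t = RtoC (Rmax 0 (t - lam)).
Proof.
move=> lam0 t0; rewrite mkcfunE // (is_RInt_unique _ _ _ _ (@is_RInt_Hstep lam t t0)).
by rewrite (Rmax_right 0 lam).
Qed.

Lemma cmulE (f g : cfun) (t : R) : 0 <= t -> cmul f g t = cconv f g t.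
Proof. exact: mkcfunE. Qed.

Lemma RInt_Cscal (c : C) (f : R -> C) (a b : R) :
  (forall x, continuous f x) ->
  RInt (V := C_R_CompleteNormedModule) (fun u => Cmult c (f u)) a b =
  Cmult c (RInt (V := C_R_CompleteNormedModule) f a b).
Proof.
move=> Hf.
have [f1 f2] := (fun x => continuous_re (Hf x), fun x => continuous_im (Hf x)).
have ex (g : R -> R) : (forall x, continuous g x) -> is_RInt g a b (RInt g a b).
  move=> Hg; apply: (RInt_correct (V := R_CompleteNormedModule)).
  by apply: (@ex_RInt_continuous R_CompleteNormedModule).
pose I1 := RInt (fun u => fst (f u)) a b; pose I2 := RInt (fun u => snd (f u)) a b.
have -> : RInt (V := C_R_CompleteNormedModule) f a b = (I1, I2).
  apply: (is_RInt_unique (V := C_R_CompleteNormedModule)).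
  by apply: (@is_RInt_fct_extend_pair R_NormedModule R_NormedModule); apply: ex.
apply: (is_RInt_unique (V := C_R_CompleteNormedModule)).
apply: (@is_RInt_fct_extend_pair R_NormedModule R_NormedModule) => /=.
  apply: (is_RInt_minus (V := R_NormedModule)); apply: (is_RInt_scal (V := R_NormedModule)); exact: ex.
apply: (is_RInt_plus (V := R_NormedModule)); apply: (is_RInt_scal (V := R_NormedModule)); exact: ex.
Qed.

Lemma cder_add (f g : cfun) : cder (cadd f g) = cadd (cder f) (cder g).
Proof. by apply: cfunP => t t0; rewrite !mkcfunE // Cmult_plus_distr_l. Qed.

Lemma ctau_add (q : R) (f g : cfun) : 0 <= q ->
  ctau q (cadd f g) = cadd (ctau q f) (ctau q g).
Proof.
move=> q0; apply: cfunP => t t0; rewrite !mkcfunE // ?Cmult_plus_distr_l //.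
exact: Rmult_le_pos.
Qed.

Lemma cder_mul (f g : cfun) :
  cder (cmul f g) = cadd (cmul (cder f) g) (cmul f (cder g)).
Proof.
have cc := continuous_cf; apply: cfunP => t t0; rewrite !mkcfunE // /cconv.
rewrite -RInt_Cscal; last first.
  by move=> x; apply: continuous_Cmul => //; apply: continuous_rev.
have -> (u v : C) : Cplus u v = plus (u : C_R_CompleteNormedModule) v by [].
rewrite -(RInt_plus (V := C_R_CompleteNormedModule)); first last.
- by apply: ex_RInt_conv.
- by apply: ex_RInt_conv.
apply: (RInt_ext (V := C_R_CompleteNormedModule)) => x; rewrite Rmin_left // Rmax_right // => Hx.
rewrite /= !(Rmax_right 0) ; try lra.
rewrite /plus /=; have -> : RtoC (- t) = Cplus (RtoC (- (t - x))) (RtoC (- x)).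
  by rewrite -RtoC_plus; congr RtoC; lra.
have E (p r y z : C) : Cmult (Cplus p r) (Cmult y z) =
  Cplus (Cmult (Cmult p y) z) (Cmult y (Cmult r z)) by ring.
exact: E.
Qed.

Lemma ctau_mul (q : R) (f g : cfun) : 0 <= q ->
  ctau q (cmul f g) = cmul (ctau q f) (ctau q g).
Proof.
have cc := continuous_cf; move=> q0; apply: cfunP => t t0.
have qt0 : 0 <= q * t by apply: Rmult_le_pos.
rewrite !mkcfunE // /cconv.
have := @RInt_comp_lin C_R_CompleteNormedModule (fun u => Cmult (f (q * t - u)) (g u)) q 0 0 t.
rewrite Rmult_0_r !Rplus_0_r => <-; last first.
  by apply: ex_RInt_conv.
rewrite -RInt_Cscal; last first.
  move=> x; apply: (continuous_ext (fun y =>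
    Cmult (RtoC q) (Cmult (f (- q * y + q * t)) (g (q * y + 0))))).
    move=> y; have -> : - q * y + q * t = q * t - (q * y + 0) by lra.
    exact: esym (scal_R_Cmult _ _).
  apply: continuous_Cmul; first exact: continuous_const.
  by apply: continuous_Cmul; apply: continuous_lin.
apply: (RInt_ext (V := C_R_CompleteNormedModule)) => x; rewrite Rmin_left // Rmax_right // => Hx.
rewrite /= !(Rmax_right 0) ; try lra.
have -> : q * t - (q * x + 0) = q * (t - x) by lra.
have E (y z : C) : Cmult (RtoC q) (Cmult (RtoC q) (Cmult y z)) =
  Cmult (Cmult (RtoC q) y) (Cmult (RtoC q) z) by ring.
by rewrite Rplus_0_r -E; congr Cmult; apply: scal_R_Cmult.
Qed.

Lemma ctauK (q r : R) : 0 <= q -> 0 <= r -> q * r = 1 -> cancel (ctau q) (ctau r).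
Proof.
move=> q0 r0 qr f; apply: cfunP => t t0.
have rt0 : 0 <= r * t by apply: Rmult_le_pos.
rewrite !mkcfunE // Cmult_assoc -RtoC_mult (Rmult_comm r) qr Cmult_1_l.
by rewrite -Rmult_assoc qr Rmult_1_l.
Qed.

End CFunTheory.

Definition czero : cfun := cconst (RtoC 0).
Definition cone : cfun := cconst (RtoC 1).

From mathcomp Require Import ring.
Import GRing.Theory.
Local Open Scope ring_scope.

(* [cfun] has no unit, so {fraction _} does not apply.  A field of fractions
   of [cfun] is a field with an injective ring morphism from [cfun] such that
   every element is a quotient a / b with a, b in [cfun] and b <> 0; this
   determines it up to unique isomorphism over [cfun]. *)
Record fraction_field := FractionField {
  ff_sort :> fieldType;
  ff_emb : cfun -> ff_sort;
  ff_emb_inj : injective ff_emb;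
  ff_emb_add : forall a b, ff_emb (cadd a b) = ff_emb a + ff_emb b;
  ff_emb_mul : forall a b, ff_emb (cmul a b) = ff_emb a * ff_emb b;
  ff_fraction : forall x : ff_sort,
    exists ab : cfun * cfun, ab.2 <> czero /\ x = ff_emb ab.1 / ff_emb ab.2 }.

(* A chosen numerator and denominator; [tauQ_frac] and [ddsQ_frac] below show
   that nothing depends on the choice. *)
Definition fracrep (Q : fraction_field) (x : Q) : cfun * cfun :=
  proj1_sig (constructive_indefinite_description _ (ff_fraction x)).

Definition tauQ (Q : fraction_field) (q : R) (x : Q) : Q :=
  ff_emb Q (ctau q (fracrep x).1) / ff_emb Q (ctau q (fracrep x).2).

Definition ddsQ (Q : fraction_field) (x : Q) : Q :=
  let: (a, b) := fracrep x in
  (ff_emb Q (cder a) * ff_emb Q b - ff_emb Q a * ff_emb Q (cder b))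
    / ff_emb Q b ^+ 2.

Definition lQ (Q : fraction_field) : Q := ff_emb Q cone.
Definition sQ (Q : fraction_field) : Q := 1 / lQ Q.

(* This is h^lam for lam >= 0; other values of lam are not meaningful. *)
Definition translation (Q : fraction_field) (lam : R) : Q :=
  sQ Q * (ff_emb Q (cintH lam) / lQ Q).

Definition hQ (Q : fraction_field) : Q := translation Q 1%R.

Definition sigmaQ (Q : fraction_field) (d : nat) : Q -> Q :=
  tauQ (1 / INR d)%R.

Definition DprimeQ (Q : fraction_field) (x : Q) : Q := - (hQ Q)^-1 * ddsQ x.

Definition derivation (K : fieldType) (D : K -> K) : Prop :=
  {morph D : x y / x + y} /\ forall x y, D (x * y) = D x * y + x * D y.

Definition transforming (K : fieldType) (tr : K -> K) : Prop :=
  [/\ {morph tr : x y / x + y}, {morph tr : x y / x * y}, tr 1 = 1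
    & injective tr].

Definition DT_field (K : fieldType) (D tr : K -> K) : Prop :=
  derivation D /\ transforming tr.

Section FractionFieldTheory.
Variable Q : fraction_field.
Local Notation emb := (ff_emb Q).

Lemma fracrepP (x : Q) :
  (fracrep x).2 <> czero /\ x = emb (fracrep x).1 / emb (fracrep x).2.
Proof. exact: proj2_sig (constructive_indefinite_description _ (ff_fraction x)). Qed.

Lemma cadd00 : cadd czero czero = czero.
Proof. by apply: cfunP => t t0; rewrite !mkcfunE // Cplus_0_l. Qed.

Lemma emb0 : emb czero = 0.
Proof. by apply: (addrI (emb czero)); rewrite -ff_emb_add cadd00 addr0. Qed.

Lemma emb_neq0 (a : cfun) : a <> czero -> emb a != 0.
Proof. by move=> a0; apply/eqP; rewrite -emb0 => /(@ff_emb_inj Q). Qed.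

Lemma ctau0 (q : R) : (0 <= q)%R -> ctau q czero = czero.
Proof.
by move=> q0; apply: cfunP => t t0; rewrite !mkcfunE ?Cmult_0_r //; apply: Rmult_le_pos.
Qed.

Lemma ctau_neq0 (q : R) (a : cfun) : (0 < q)%R -> a <> czero -> ctau q a <> czero.
Proof.
move=> q0 a0 E; apply: a0.
have q0' := Rlt_le _ _ q0; have r0' := Rlt_le _ _ (Rinv_0_lt_compat _ q0).
have K : cancel (ctau q) (ctau (/ q)).
  by apply: ctauK => //; apply: Rinv_r; apply: Rgt_not_eq.
by rewrite -(K a) E ctau0.
Qed.

Lemma cone_neq0 : cone <> czero.
Proof.
move=> E; have : cone 0%R = czero 0%R by rewrite E.
by move=> [] /R1_neq_R0.
Qed.

(* The complex numbers embed as {alpha} / {1}; on natural numbers this is the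
   generic embedding into Q. *)
Lemma natQ (n : nat) : n%:R = emb (cconst (RtoC (INR n))) / lQ Q.
Proof.
have l0 : lQ Q != 0 := emb_neq0 cone_neq0.
elim: n => [|n IH]; first by rewrite -[cconst _]/czero emb0 mul0r.
rewrite mulrS IH -[X in X + _](divff l0) -mulrDl addrC -ff_emb_add.
congr (emb _ / _); apply: cfunP => t t0; rewrite !mkcfunE //.
by rewrite S_INR RtoC_plus.
Qed.

Lemma tauQ_frac (q : R) (a b : cfun) : (0 < q)%R -> b <> czero ->
  tauQ q (emb a / emb b) = emb (ctau q a) / emb (ctau q b).
Proof.
move=> q0 b0; rewrite /tauQ; set x := emb a / emb b.
have [d0 E] := fracrepP x; case: (fracrep x) d0 E => c d /= d0; rewrite {}/x.
have q0' := Rlt_le _ _ q0.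
move/eqP; rewrite eqr_div ?emb_neq0 // -!ff_emb_mul => /eqP /(@ff_emb_inj Q) E.
apply/esym/eqP; rewrite eqr_div ?emb_neq0 //; try exact: ctau_neq0.
by rewrite -!ff_emb_mul -!ctau_mul // E.
Qed.

Lemma ddsQ_frac (a b : cfun) : b <> czero ->
  ddsQ (emb a / emb b) =
  (emb (cder a) * emb b - emb a * emb (cder b)) / emb b ^+ 2.
Proof.
move=> b0; rewrite /ddsQ; set x := emb a / emb b.
have [d0 E] := fracrepP x; case: (fracrep x) d0 E => c d /= d0; rewrite {}/x.
have [nb nd] := (emb_neq0 b0, emb_neq0 d0).
move=> E0; have := E0; move/eqP; rewrite eqr_div // -!ff_emb_mul => /eqP /(@ff_emb_inj Q) E.
have := congr1 (fun f => emb (cder f)) E; rewrite !cder_mul !ff_emb_add !ff_emb_mul.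
move=> E1; apply/esym/eqP; rewrite eqr_div ?expf_neq0 //; apply/eqP.
move/eqP: E0; rewrite eqr_div // => /eqP E0.
move: (emb a) (emb b) (emb c) (emb d) (emb (cder a)) (emb (cder b)) (emb (cder c)) (emb (cder d)) nb nd E0 E1.
move=> A B C D A' B' C' D' nb nd E0 E1.
have -> : (A' * B - A * B') * D ^+ 2 = (A' * D) * (B * D) - (A * D) * (B' * D) by ring.
have -> : (A' * D) = C' * B + C * B' - A * D' by rewrite -E1; ring.
have -> : (C' * B + C * B' - A * D') * (B * D) - A * D * (B' * D) =
   (C' * B + C * B') * B * D - (A * D) * (B * D' + B' * D) by ring.
by rewrite E0; ring.
Qed.

Lemma emb_frac (a b : cfun) : b <> czero -> emb a = emb (cmul a b) / emb b.
Proof. by move=> b0; rewrite ff_emb_mul mulfK // emb_neq0. Qed.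

Lemma tauQ_emb (q : R) (a : cfun) : (0 < q)%R ->
  tauQ q (emb a) = emb (ctau q a).
Proof.
move=> q0; have c0 := ctau_neq0 q0 cone_neq0.
rewrite {1}(emb_frac a cone_neq0) tauQ_frac //; last exact: cone_neq0.
by rewrite ctau_mul -?emb_frac //; apply: Rlt_le.
Qed.

Lemma ddsQ_emb (a : cfun) : ddsQ (emb a) = emb (cder a).
Proof.
rewrite {1}(emb_frac a cone_neq0) (ddsQ_frac _ cone_neq0) cder_mul.
have := emb_neq0 cone_neq0; rewrite !(ff_emb_add, ff_emb_mul).
by move: (emb a) (emb cone) (emb (cder a)) (emb (cder cone)) => A B A' B' nb; field.
Qed.

Lemma tauQ_bij (q : R) : (0 < q)%R -> bijective (@tauQ Q q).
Proof.
move=> q0; have r0 := Rinv_0_lt_compat _ q0.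
have [q0' r0'] := (Rlt_le _ _ q0, Rlt_le _ _ r0).
exists (@tauQ Q (/ q)%R) => x; have [b0 {1}->] := fracrepP x; rewrite !tauQ_frac //;
  try exact: ctau_neq0; rewrite !ctauK -?(proj2 (fracrepP x)) //.
all: by [apply: Rinv_r; apply: Rgt_not_eq | apply: Rinv_l; apply: Rgt_not_eq].
Qed.

End FractionFieldTheory.

(* Main.v *)
(** Write [S_a f] for the function [f] delayed by [a] and [r] for the ramp
    [r t = t = l * l], so that [h^a = S_a r / r].  Delays commute with
    convolution, [S_a f * S_b g = S_(a+b) (f * g)] when [f 0 = g 0 = 0], with
    [tau_q] (up to rescaling the delay by [1/q]), and with multiplication by
    [-t] up to the term [- a S_a f].  The first two facts give
    [h^a h^b = h^(a+b)] and [tau_q h = h^(1/q)], the third gives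
    [dh/ds = - h].  Finally [d/ds] and [sigma_d] commute up to the factor [d]
    already on [cfun], and dividing by [- h] turns this into the relation for
    [D']. *)

Require Import Defs.
From mathcomp Require Import all_boot all_algebra.
From Stdlib Require Import Reals Lra.
From Coquelicot Require Import Coquelicot.
From mathcomp Require Import ring.
Import GRing.Theory.
Delimit Scope nat_scope with N.
Local Open Scope ring_scope.

(** * Delays on [cfun]: their interplay with convolution, dilation and multiplication by [-t] *)

Section Delay.
Local Open Scope R_scope.

Lemma cf_le0 (f : cfun) (t : R) : t <= 0 -> f t = f 0.
Proof. by move=> t0; rewrite -cf_neg Rmax_left. Qed.

Lemma delay_cont (a : R) (f : cfun) : continuous_on Defs.nonneg (fun t => f (t - a)).
Proof.
apply: cont_on => x _; apply: (continuous_ext (fun t => f (1 * t + - a))).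
  by move=> t; congr (cf f _); lra.
by apply: continuous_lin => y; apply: continuous_cf.
Qed.

(* For [t < a] the value is [f 0], so this is the delay operator only when
   [f 0 = 0]. *)
Definition delay (a : R) (f : cfun) : cfun := mkcfun (@delay_cont a f).

Lemma delayE (a t : R) (f : cfun) : 0 <= t -> delay a f t = f (t - a).
Proof. exact: mkcfunE. Qed.

Lemma delay0 (f : cfun) : delay 0 f = f.
Proof. by apply: cfunP => t t0; rewrite delayE // Rminus_0_r. Qed.

Lemma cmul_at0 (f g : cfun) : cmul f g 0 = RtoC 0.
Proof.
rewrite cmulE; last lra.
exact: (@RInt_point C_R_CompleteNormedModule).
Qed.

Lemma RInt_eq0 (f : R -> C) (a b : R) : a <= b ->
  (forall x, a < x < b -> f x = RtoC 0) ->
  RInt (V := C_R_CompleteNormedModule) f a b = RtoC 0.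
Proof.
move=> ab f0.
rewrite (RInt_ext (V := C_R_CompleteNormedModule) _ (fun=> RtoC 0)); last first.
  by move=> x; rewrite Rmin_left // Rmax_right // => /f0.
rewrite (RInt_const (V := C_R_CompleteNormedModule)).
exact: (scal_zero_r (V := C_R_NormedModule)).
Qed.

(** The first factor of the integrand vanishes for [u >= t - a], the second for [u <= b]. Nothing
    remains when [t <= a + b]; otherwise the integral lives on [[b, t - a]], and shifting [u] by [b]
    gives the convolution at [t - (a + b)]. *)
Lemma delay_cmul (a b : R) (f g : cfun) : 0 <= a -> 0 <= b ->
  f 0 = RtoC 0 -> g 0 = RtoC 0 ->
  cmul (delay a f) (delay b g) = delay (a + b) (cmul f g).
Proof.
move=> a0 b0 f0 g0; apply: cfunP => t t0; rewrite cmulE // delayE // /cconv.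
(* [p] is the integrand without the clamps that [delay] puts on its arguments, which are inactive
   for [0 < u < t]. *)
pose p (u : R) : C := Cmult (f (t - u - a)) (g (u - b)).
have -> : RInt (V := C_R_CompleteNormedModule)
    (fun u => Cmult (delay a f (t - u)) (delay b g u)) 0 t =
    RInt (V := C_R_CompleteNormedModule) p 0 t.
  apply: (RInt_ext (V := C_R_CompleteNormedModule)) => u.
  by rewrite Rmin_left // Rmax_right // => Hu; rewrite !delayE //; lra.
have pl u : u <= b -> p u = RtoC 0.
  by move=> ub; rewrite /p (@cf_le0 g) ?g0 ?Cmult_0_r //; lra.
have pr u : t - a <= u -> p u = RtoC 0.
  by move=> ua; rewrite /p (@cf_le0 f) ?f0 ?Cmult_0_l //; lra.
case: (Rle_dec t (a + b)) => Ht.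
  rewrite (@cf_le0 (cmul f g)) ?cmul_at0; last lra.
  apply: RInt_eq0 => // u Hu.
  by case: (Rle_dec u b) => ?; [apply: pl | apply: pr; lra].
rewrite cmulE; last lra.
have pE u : p u = Cmult (f ((t - a) - u)) (g (1 * u + - b)).
  by rewrite /p; congr (Cmult (cf f _) (cf g _)); lra.
have pc u : continuous p u.
  apply: (continuous_ext (fun u => Cmult (f ((t - a) - u)) (g (1 * u + - b)))).
    by move=> v; rewrite pE.
  apply: continuous_Cmul.
    by apply: continuous_rev => y; apply: continuous_cf.
  by apply: continuous_lin => y; apply: continuous_cf.
have pI x y : @ex_RInt C_R_NormedModule p x y.
  by apply: (@ex_RInt_continuous C_R_CompleteNormedModule) => z _.
rewrite -(RInt_Chasles (V := C_R_CompleteNormedModule) p 0 b t) //.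
rewrite -(RInt_Chasles (V := C_R_CompleteNormedModule) p b (t - a) t) //.
rewrite (RInt_eq0 p 0 b) //; last by move=> u Hu; apply: pl; lra.
rewrite (RInt_eq0 p (t - a) t); [|lra|by move=> u Hu; apply: pr; lra].
rewrite (plus_zero_r (G := C_R_NormedModule)) (plus_zero_l (G := C_R_NormedModule)).
have := @RInt_comp_lin C_R_CompleteNormedModule p 1 b 0 (t - (a + b)) (pI _ _).
have -> : 1 * 0 + b = b by lra.
have -> : 1 * (t - (a + b)) + b = t - a by lra.
move=> <-; apply: (RInt_ext (V := C_R_CompleteNormedModule)) => u _.
rewrite (scal_one (V := C_R_NormedModule)) /p /cconv.
by congr (Cmult (cf f _) (cf g _)); lra.
Qed.

Lemma ctau_delay (q a b : R) (f : cfun) : 0 <= q -> q * b = a ->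
  ctau q (delay a f) = delay b (ctau q f).
Proof.
move=> q0 qb; apply: cfunP => t t0; have qt0 : 0 <= q * t by apply: Rmult_le_pos.
rewrite mkcfunE // !delayE // -(cf_neg (ctau q f)) mkcfunE; last exact: Rmax_l.
(* For [t < b] the argument is negative; the clamp at [0] commutes with multiplication by
   [q >= 0]. *)
congr Cmult; rewrite -cf_neg -[RHS]cf_neg; congr (cf f _).
rewrite -RmaxRmult // Rmult_0_r [Rmax 0 (Rmax 0 _)]Rmax_right; last exact: Rmax_l.
by congr Rmax; rewrite -qb; lra.
Qed.

(** For [t > 1] this is [-t + 1 = -(t - 1)] times [f (t - 1)]; for [t <= 1] every term vanishes
    because [f 0 = 0]. *)
Lemma cder_delay1 (f : cfun) : f 0 = RtoC 0 ->
  cadd (cder (delay 1 f)) (delay 1 f) = delay 1 (cder f).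
Proof.
move=> f0; apply: cfunP => t t0; rewrite delayE // mkcfunE // mkcfunE // !delayE //.
case: (Rle_dec t 1) => t1.
  rewrite (@cf_le0 f) 1?(@cf_le0 (cder f)) ?mkcfunE ?f0; try lra.
  by rewrite !Cmult_0_r Cplus_0_l.
rewrite mkcfunE; last lra.
have -> : RtoC (- (t - 1)) = Cplus (RtoC (- t)) (RtoC 1).
  by rewrite -RtoC_plus; congr RtoC; lra.
by rewrite Cmult_plus_distr_r Cmult_1_l.
Qed.

Lemma cintH_delay (a : R) : 0 <= a -> cintH a = delay a (cintH 0).
Proof.
move=> a0; apply: cfunP => t t0; rewrite cintHE // delayE //.
rewrite -(cf_neg (cintH 0)) cintHE; [|lra|exact: Rmax_l].
by rewrite Rminus_0_r [Rmax 0 (Rmax _ _)]Rmax_right //; apply: Rmax_l.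
Qed.

Lemma cintH0_at0 : cintH 0 0 = RtoC 0.
Proof. by rewrite cintHE; [congr RtoC; rewrite Rmax_left|..]; lra. Qed.

Lemma cmul_cone_cone : cmul cone cone = cintH 0.
Proof.
apply: cfunP => t t0; rewrite cmulE // cintHE //; last lra.
rewrite /cconv /= (RInt_const (V := C_R_CompleteNormedModule)).
rewrite scal_R_Cmult !Cmult_1_r; congr RtoC.
by rewrite Rminus_0_r Rmax_right.
Qed.

Lemma cintH_neq0 (a : R) : 0 <= a -> cintH a <> czero.
Proof.
move=> a0 E; have : cintH a (a + 1) = czero (a + 1) by rewrite E.
by rewrite cintHE //; [|lra]; rewrite Rmax_right /=; [case|]; lra.
Qed.

End Delay.

(** * Formal consequences of the axioms for transforming operators and derivations *)

Lemma transformingN (K : fieldType) (tr : K -> K) :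
  transforming tr -> {morph tr : x / - x}.
Proof.
move=> [trA _ _ _] x.
have tr0 : tr 0 = 0 by apply: (addrI (tr 0)); rewrite -trA !addr0.
by apply: (addrI (tr x)); rewrite -trA !subrr.
Qed.

Lemma transformingV (K : fieldType) (tr : K -> K) :
  transforming tr -> {morph tr : x / x^-1}.
Proof.
move=> [trA trM tr1 _] x.
have tr0 : tr 0 = 0 by apply: (addrI (tr 0)); rewrite -trA !addr0.
have [->|x0] := eqVneq x 0; first by rewrite invr0 tr0 invr0.
have E : tr x * tr x^-1 = 1 by rewrite -trM divff.
have trx0 : tr x != 0.
  by apply/eqP => z; move: E; rewrite z mul0r => /esym/eqP; rewrite oner_eq0.
by apply: (mulfI trx0); rewrite E divff.
Qed.

Lemma derivation_scale (K : fieldType) (c : K) (D : K -> K) :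
  derivation D -> derivation (fun x => c * D x).
Proof.
move=> [Da Dm]; split=> x y; first by rewrite Da mulrDr.
by rewrite Dm mulrDr mulrA mulrCA.
Qed.

(** * Translation operators in [Q], and the action of [tauQ] and [ddsQ] on them *)

Section FractionField.
Variable Q : fraction_field.
Local Notation emb := (ff_emb Q).

Lemma emb_mulC (f g : cfun) : emb (cmul f g) = emb (cmul g f).
Proof. by rewrite !ff_emb_mul mulrC. Qed.

(** Scaling by [n] is an [n]-fold sum, so additivity of [emb] suffices. This carries the factor [d]
    from [cfun] to [Q]. *)
Lemma emb_natmul (n : nat) (f g : cfun) :
  (forall t, (0 <= t)%R -> g t = Cmult (RtoC (INR n)) (f t)) ->
  emb g = n%:R * emb f.
Proof.
elim: n g => [|n IH] g gE.
  rewrite mul0r -(emb0 Q); congr emb; apply: cfunP => t t0.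
  by rewrite gE // mkcfunE //= Cmult_0_l.
have fc : continuous_on Defs.nonneg (fun t => Cmult (RtoC (INR n)) (f t)).
  apply: cont_on => x _; apply: continuous_Cmul; first exact: continuous_const.
  exact: continuous_cf.
rewrite mulrS mulrDl mul1r -(IH (mkcfun fc)); last by move=> t t0; rewrite mkcfunE.
rewrite -ff_emb_add; congr emb; apply: cfunP => t t0.
rewrite gE // !mkcfunE // S_INR RtoC_plus Cmult_plus_distr_r Cmult_1_l.
exact: Cplus_comm.
Qed.

Lemma lQ_neq0 : lQ Q != 0.
Proof. exact: emb_neq0 cone_neq0. Qed.

Lemma emb_cintH_neq0 (a : R) : (0 <= a)%R -> emb (cintH a) != 0.
Proof. by move=> a0; apply: emb_neq0; apply: cintH_neq0. Qed.

(** [s / l = 1 / l^2], and [l^2] is the ramp [cintH 0]. *)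
Lemma translationE (a : R) : translation Q a = emb (cintH a) / emb (cintH 0).
Proof.
rewrite /translation /sQ -cmul_cone_cone ff_emb_mul -/(lQ Q).
by have := lQ_neq0; move: (lQ Q) (emb _) => l c l0; field.
Qed.

Lemma translationD (a b : R) : (0 <= a)%R -> (0 <= b)%R ->
  translation Q (a + b) = translation Q a * translation Q b.
Proof.
move=> a0 b0; have ab0 := Rplus_le_le_0_compat _ _ a0 b0.
have r0 := cintH0_at0; have n0 := emb_cintH_neq0 _ (Rle_refl 0).
rewrite !translationE mulf_div; apply/eqP; rewrite eqr_div ?mulf_neq0 //.
rewrite mulrA; apply/eqP; congr (_ * _); rewrite -!ff_emb_mul; congr emb.
rewrite (cintH_delay (a + b)) // (cintH_delay a) // (cintH_delay b) //.
(* The undelayed ramp is read as a delay by [0], so that [delay_cmul] applies to both sides. *)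
rewrite delay_cmul // -{2}(delay0 (cintH 0)) delay_cmul //; last exact: Rle_refl.
by rewrite Rplus_0_r.
Qed.

Lemma translation_nat (n : nat) : translation Q (INR n) = hQ Q ^+ n.
Proof.
elim: n => [|n IH].
  by rewrite translationE divff //; apply: emb_cintH_neq0; apply: Rle_refl.
rewrite S_INR translationD ?IH ?exprSr //; first exact: pos_INR.
exact: Rle_0_1.
Qed.

Lemma hQ_neq0 : hQ Q != 0.
Proof.
rewrite /hQ translationE mulf_neq0 ?invr_eq0 //; apply: emb_cintH_neq0.
  exact: Rle_0_1.
exact: Rle_refl.
Qed.

(** With denominators cleared, [tau_q (S_a r) * r = S_b (tau_q r) * r = tau_q r * S_b r]: a delay
    may move from one factor of a convolution to the other. *)
Lemma tauQ_translation (q a b : R) : (0 < q)%R -> (0 <= b)%R -> (q * b)%R = a ->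
  tauQ q (translation Q a) = translation Q b.
Proof.
move=> q0 b0 qb; have q0' := Rlt_le _ _ q0.
have a0 : (0 <= a)%R by rewrite -qb; apply: Rmult_le_pos.
have r0 := cintH0_at0; have nz := cintH_neq0 _ (Rle_refl 0).
have tr0 : ctau q (cintH 0) 0%R = RtoC 0.
  by rewrite mkcfunE ?Rmult_0_r ?r0 ?Cmult_0_r //; apply: Rle_refl.
rewrite !translationE tauQ_frac //; apply/eqP.
rewrite eqr_div ?emb_neq0 //; last exact: ctau_neq0.
rewrite -!ff_emb_mul (cintH_delay a) // (cintH_delay b) // (ctau_delay q a b) //.
apply/eqP; rewrite [RHS]emb_mulC; congr emb.
rewrite -{2}(delay0 (cintH 0)) -{2}(delay0 (ctau q (cintH 0))).
by rewrite !delay_cmul ?Rplus_0_r ?Rplus_0_l //; apply: Rle_refl.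
Qed.

(** Write [R = S_1 r] and a prime for [cder]. Then [R' = S_1 r' - R] and [S_1 r' * r = R * r'], so
    the numerator [R' r - R r'] of the quotient rule collapses to [- R r]. *)
Lemma ddsQ_hQ : ddsQ (hQ Q) = - hQ Q.
Proof.
have nz := cintH_neq0 _ (Rle_refl 0); have n0 := emb_neq0 Q nz.
have r0 := cintH0_at0; have le01 := Rle_0_1; have le00 := Rle_refl 0.
have d0 : cder (cintH 0) 0%R = RtoC 0.
  by rewrite mkcfunE ?r0 ?Cmult_0_r.
have E1 : emb (cder (cintH 1)) + emb (cintH 1) = emb (delay 1 (cder (cintH 0))).
  by rewrite -ff_emb_add (cintH_delay 1) // cder_delay1.
have E2 : emb (delay 1 (cder (cintH 0))) * emb (cintH 0) =
          emb (cintH 1) * emb (cder (cintH 0)).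
  rewrite -!ff_emb_mul [RHS]emb_mulC (cintH_delay 1) //; congr emb.
  rewrite -{2}(delay0 (cintH 0)) -{2}(delay0 (cder (cintH 0))).
  by rewrite !delay_cmul // Rplus_0_r Rplus_0_l.
rewrite /hQ translationE ddsQ_frac //.
move: E1 E2 => <- E2; rewrite -E2.
by move: (emb _) (emb _) (emb _) n0 => x y z y0; field.
Qed.

Lemma DprimeQ_hQ : DprimeQ (hQ Q) = 1.
Proof. by rewrite /DprimeQ ddsQ_hQ mulrNN mulVf // hQ_neq0. Qed.

(** * The derivation and the transforming operator on fractions *)

(** The injective [emb] pulls this back from the field: Titchmarsh's theorem is contained in the
    existence of [Q]. *)
Lemma cmul_neq0 (a b : cfun) : a <> czero -> b <> czero -> cmul a b <> czero.
Proof.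
move=> a0 b0 /(congr1 emb); rewrite ff_emb_mul emb0 => /eqP.
by rewrite mulf_eq0 (negbTE (emb_neq0 Q a0)) (negbTE (emb_neq0 Q b0)).
Qed.

Lemma add_frac (a b c e : cfun) : b <> czero -> e <> czero ->
  emb a / emb b + emb c / emb e =
  emb (cadd (cmul a e) (cmul c b)) / emb (cmul b e).
Proof. by move=> /(emb_neq0 Q) b0 /(emb_neq0 Q) e0; rewrite addf_div // ff_emb_add !ff_emb_mul. Qed.

Lemma mul_frac (a b c e : cfun) :
  emb a / emb b * (emb c / emb e) = emb (cmul a c) / emb (cmul b e).
Proof. by rewrite mulf_div !ff_emb_mul. Qed.

Lemma ddsQ_derivation : derivation (@ddsQ Q).
Proof.
split=> x y; have [b0 ->] := fracrepP x; have [e0 ->] := fracrepP y.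
all: move: (fracrep x).1 (fracrep x).2 (fracrep y).1 (fracrep y).2 b0 e0 => a b c e b0 e0.
all: have be0 := cmul_neq0 _ _ b0 e0; have [nb ne] := (emb_neq0 Q b0, emb_neq0 Q e0).
  rewrite add_frac // !ddsQ_frac // !(cder_add, cder_mul, ff_emb_add, ff_emb_mul).
  (* What remains is a rational identity, valid for any eight field elements with [B] and [E]
     nonzero. *)
  move: nb ne; move: (emb a) (emb b) (emb c) (emb e)
    (emb (cder a)) (emb (cder b)) (emb (cder c)) (emb (cder e)).
  by move=> A B C E A' B' C' E' nb ne; field; rewrite nb ne.
rewrite mul_frac !ddsQ_frac // !(cder_mul, ff_emb_add, ff_emb_mul).
move: nb ne; move: (emb a) (emb b) (emb c) (emb e)
  (emb (cder a)) (emb (cder b)) (emb (cder c)) (emb (cder e)).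
by move=> A B C E A' B' C' E' nb ne; field; rewrite nb ne.
Qed.

Lemma tauQ_transforming (q : R) : (0 < q)%R -> transforming (@tauQ Q q).
Proof.
move=> q0; have q0' := Rlt_le _ _ q0; split.
- move=> x y; have [b0 ->] := fracrepP x; have [e0 ->] := fracrepP y.
  have [tb0 te0] := (ctau_neq0 q0 b0, ctau_neq0 q0 e0); have be0 := cmul_neq0 _ _ b0 e0.
  by rewrite add_frac // !tauQ_frac // add_frac // ctau_add // !ctau_mul.
- move=> x y; have [b0 ->] := fracrepP x; have [e0 ->] := fracrepP y.
  by rewrite mul_frac !tauQ_frac ?mul_frac ?ctau_mul //; apply: cmul_neq0.
(* [cfun] has no unit, so [1] is represented by [l / l]. *)
- rewrite -(divff lQ_neq0) (tauQ_frac Q _ q0 cone_neq0) !divff ?lQ_neq0 //.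
  by apply: emb_neq0; apply: ctau_neq0 cone_neq0.
- exact: bij_inj (tauQ_bij Q q0).
Qed.

(** On [cfun], [-t q a(q t) = d q (-(q t)) a(q t)] since [d q = 1]. The quotient rule is linear in
    the derivatives, so the factor [d] comes out of fractions too. *)
Lemma ddsQ_sigmaQ (d : nat) (x : Q) : (0 < d)%N ->
  ddsQ (sigmaQ d x) = d%:R * sigmaQ d (ddsQ x).
Proof.
move=> d0; have id0 : (0 < INR d)%R by apply: lt_0_INR; apply/ltP.
have q0 : (0 < 1 / INR d)%R by apply: Rdiv_lt_0_compat => //; exact: Rlt_0_1.
rewrite /sigmaQ; move: q0; set q := (1 / INR d)%R => q0.
have dq : (INR d * q = 1)%R by rewrite /q Rdiv_1_l Rinv_r //; lra.
have E (a : cfun) : emb (cder (ctau q a)) = d%:R * emb (ctau q (cder a)).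
  apply: emb_natmul => t t0.
  have qt0 : (0 <= q * t)%R by apply: Rmult_le_pos => //; apply: Rlt_le.
  rewrite !mkcfunE // !Cmult_assoc; congr (Cmult _ _).
  rewrite -!RtoC_mult; congr RtoC.
  by transitivity ((INR d * q) * (- (q * t)))%R; rewrite ?dq; lra.
have [b0 ->] := fracrepP x; move: (fracrep x).1 (fracrep x).2 b0 => a b b0.
have tb0 := ctau_neq0 q0 b0; have n0 := emb_neq0 Q tb0.
have tr := tauQ_transforming _ q0; have [tA tM _ _] := tr.
rewrite tauQ_frac // !ddsQ_frac // tM tA (transformingN _ _ tr) (transformingV _ _ tr) !expr2.
by rewrite !tM !(tauQ_emb Q _ q0) !E; field.
Qed.

End FractionField.

Theorem theorem3p5 (Q : fraction_field) (d : nat) (d_gt1 : (1 < d)%N) :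
  [/\ sigmaQ d (hQ Q) = hQ Q ^+ d,
      DprimeQ (hQ Q) = 1,
      DT_field (@DprimeQ Q) (@sigmaQ Q d) &
      forall x : Q,
        DprimeQ (sigmaQ d x) = d%:R * hQ Q ^+ (d - 1) * sigmaQ d (DprimeQ x)].
Proof.
have d0 : (0 < d)%N := ltnW d_gt1.
have id0 : (0 < INR d)%R by apply: lt_0_INR; apply/ltP.
have q0 : (0 < 1 / INR d)%R by apply: Rdiv_lt_0_compat => //; exact: Rlt_0_1.
have tr : transforming (@sigmaQ Q d) := tauQ_transforming Q _ q0; have [_ tM _ _] := tr.
have sh : sigmaQ d (hQ Q) = hQ Q ^+ d.
  (* [h] is the translation by [1 = (1 / d) d], so its delay is stretched to [d]. *)
  rewrite -translation_nat; apply: tauQ_translation => //; first exact: pos_INR.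
  by rewrite Rdiv_1_l Rinv_l //; lra.
have h0 := hQ_neq0 Q.
split=> //; first exact: DprimeQ_hQ.
  by split=> //; apply: derivation_scale; exact: ddsQ_derivation.
move=> x.
(* With [d/ds = - h D'], applying [sigma_d] produces the factor [- h^d]; the outer [- h^-1] of [D']
   reduces it to [h^(d - 1)]. *)
have E : ddsQ x = - (hQ Q * DprimeQ x) by rewrite /DprimeQ; field.
rewrite {1}/DprimeQ ddsQ_sigmaQ // E (transformingN _ _ tr) tM sh.
(* Subtraction on [nat] is truncated; [0 < d] makes [d - 1] exact. *)
have -> : hQ Q ^+ d = hQ Q * hQ Q ^+ (d - 1) by rewrite -exprS -addn1 subnK.
by field.
Qed.
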